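(* Let $k\ge 2$ be an integer and let $G=(V,E)$ be a finite, undirected, unweighted graph with $n=|V|$ vertices that is $2(k-1)$-vertex-connected and 2-vertex-connected. If $G$ contains a spanning tree with $k$ leaves, then $G$ has a TSP tour of length at most $4n/3$.
   Context: A TSP tour of $G$ is a closed walk in $G$ that visits every vertex at least once; its length is the number of edges traversed, counted with multiplicity. A leaf of a tree is a vertex of degree $1$ in the tree. *)

(* Defs.v *)
From mathcomp Require Import all_boot.
Set Implicit Arguments. Unset Strict Implicit. Unset Printing Implicit Defensive.

Definition simple_graph (T : finType) (e : rel T) : Prop :=
  symmetric e /\ irreflexive e.

Definition del_vertices (T : finType) (e : rel T) (X : {set T}) : rel T :=
  [rel a b | [&& e a b, a \notin X & b \notin X]].

Definition vertex_connected (T : finType) (e : rel T) (c : nat) : Prop :=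
  c < #|T| /\
  forall X : {set T}, #|X| < c ->
    forall x y, x \notin X -> y \notin X -> connect (del_vertices e X) x y.

Definition spanning_tree (T : finType) (e t : rel T) : Prop :=
  symmetric t /\ subrel t e /\
  (forall x y, connect t x y) /\
  (forall c : seq T, uniq c -> 3 <= size c -> ~~ cycle t c).

Definition deg (T : finType) (t : rel T) (x : T) : nat := #|[set y | t x y]|.
Definition leaves (T : finType) (t : rel T) : {set T} := [set x | deg t x == 1].

(* A TSP tour: closed walk x :: p (consecutive vertices adjacent, ending at x)
   that visits every vertex; its length is the number of edges traversed,
   i.e. size p. *)
Definition tsp_tour (T : finType) (e : rel T) (x : T) (p : seq T) : Prop :=
  path e x p /\ last x p = x /\ (forall v : T, v \in x :: p).

(* Main.v *)
Require Import Defs.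
From mathcomp Require Import all_boot.
From mathcomp Require Import zify.
Set Implicit Arguments. Unset Strict Implicit. Unset Printing Implicit Defensive.

(* Let [O] be the set of odd-degree vertices of the spanning tree. A tree with [k] leaves
   has at most [k - 2] vertices of degree at least 3, so [#|O| <= 2 * (k - 1)] and, by
   Dirac's theorem, some cycle [c] passes through all of [O]. The points of [O] cut [c]
   into arcs; taking every other arc gives two complementary O-joins. The tree plus either
   O-join is a connected even multigraph, hence has an Eulerian tour; a third tour goes
   around [c] and reaches each vertex off [c] by a detour of length 2. The three lengths
   add up to at most [2 * (n - 1) + |c| + |c| + 2 * (n - |c|) = 4 * n - 2].

   Dirac's theorem comes from the fan lemma, which is obtained here directly from Hall's
   theorem: a fan from [v] to [C] is the family of orbits of an injective successor map. *)

Lemma connect_exit (T : finType) (r : rel T) (A : {set T}) x y :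
  connect r x y -> x \in A -> y \notin A ->
  exists a b, [/\ a \in A, b \notin A & r a b].
Proof.
case/connectP=> p; elim: p x => [|z p IHp] x /=.
  by move=> _ -> ->.
case/andP=> rxz rp y_last xA yA; case: (boolP (z \in A)) => zA; first exact: IHp zA yA.
by exists x, z.
Qed.

(** * Hall's marriage theorem *)

Section Hall.
Variables (L R : finType) (D : {set L}).

Lemma hall (r0 : R) (N : L -> {set R}) :
    (forall S : {set L}, S \subset D -> #|S| <= #|\bigcup_(x in S) N x|) ->
  exists2 g : L -> R, {in D, forall x, g x \in N x} & {in D &, injective g}.
Proof.
(* Rado's proof: delete neighbours as long as Hall's condition survives. If neither [y1]
   nor [y2] can be deleted from [N x], the two violating sets [S1], [S2] contradict the
   condition for [S1 :|: S2] and [(S1 :&: S2) :\ x] by submodularity. *)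
have [m] := ubnP (\sum_(x in D) #|N x|); elim: m N => // m IHm N lt_m hallN.
pose del x y z := if z == x then N x :\ y else N z.
case: (pickP [pred x in D | 1 < #|N x|]) => [x /andP[xD Nx_gt1] | small].
  have [y1 [y2 [y1N y2N y12]]] := card_gt1P Nx_gt1.
  pose good y := [forall S : {set L},
    (S \subset D) ==> (#|S| <= #|\bigcup_(z in S) del x y z|)].
  have from_good y : y \in N x -> good y ->
      exists2 g : L -> R, {in D, forall z, g z \in N z} & {in D &, injective g}.
    move=> yN /forallP goody; case: (IHm (del x y)) => [|S SD|g gN gI].
    - rewrite (bigD1 x) //= in lt_m; rewrite (bigD1 x) //= {1}/del eqxx.
      rewrite (eq_bigr (fun z => #|N z|)) => [|z /andP[_ zx]]; last by rewrite /del (negPf zx).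
      by move: lt_m; rewrite (cardsD1 y (N x)) yN; lia.
    - exact: implyP (goody S) SD.
    - exists g => // z zD; have := gN z zD; rewrite /del.
      by case: eqP => [->|_] //; rewrite in_setD1 => /andP[].
  case: (boolP (good y1)) => [|bad1]; first exact: from_good.
  case: (boolP (good y2)) => [|bad2]; first exact: from_good.
  have bad_set y : ~~ good y -> exists S : {set L},
      [/\ S \subset D, x \in S & #|\bigcup_(z in S) del x y z| < #|S|].
    (* A violating set must contain [x]: for any other set the deletion at [x] is invisible. *)
    case/forallPn=> S; rewrite negb_imply -ltnNge => /andP[SD ltS]; exists S; split=> //.
    apply: contraLR ltS => xS; rewrite -leqNgt (leq_trans (hallN S SD)) //.
    rewrite (eq_bigr (del x y)) // => z zS; rewrite /del.
    by case: eqP => // zx; rewrite -zx zS in xS.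
  have [S1 [S1D xS1 lt1]] := bad_set _ bad1.
  have [S2 [S2D xS2 lt2]] := bad_set _ bad2.
  set B1 := \bigcup_(z in S1) _ in lt1; set B2 := \bigcup_(z in S2) _ in lt2.
  (* Since [y1 != y2], a neighbour of [x] deleted in one of [B1], [B2] survives in the other. *)
  have subU : \bigcup_(z in S1 :|: S2) N z \subset B1 :|: B2.
    apply/bigcupsP=> z; rewrite inE => zS; apply/subsetP=> w wN; rewrite inE.
    case: (eqVneq z x) wN => [-> | zx] wN.
      case: (eqVneq w y1) => [wy1|wy1].
        apply/orP; right; apply/bigcupP; exists x => //.
        by rewrite /del eqxx in_setD1 wN wy1 y12.
      by apply/orP; left; apply/bigcupP; exists x; rewrite // /del eqxx in_setD1 wN wy1.
    by case/orP: zS => zS; apply/orP; [left|right]; apply/bigcupP; exists z;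
       rewrite // /del (negPf zx).
  have subI : \bigcup_(z in (S1 :&: S2) :\ x) N z \subset B1 :&: B2.
    apply/bigcupsP=> z; rewrite !inE => /and3P[zx z1 z2]; apply/subsetP=> w wN.
    by rewrite inE; apply/andP; split; apply/bigcupP; exists z; rewrite // /del (negPf zx).
  have hU := hallN _ (introT subUsetP (conj S1D S2D)).
  have hI : #|(S1 :&: S2) :\ x| <= #|\bigcup_(z in (S1 :&: S2) :\ x) N z|.
    by apply: hallN; apply: subset_trans (subsetDl _ _) (subset_trans (subsetIl _ _) S1D).
  (* Adding up, [#|S1| + #|S2| - 1 <= #|B1| + #|B2| <= #|S1| + #|S2| - 2]. *)
  have := subset_leq_card subU; have := subset_leq_card subI.
  have := cardsUI S1 S2; have := cardsUI B1 B2.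
  have := cardsD1 x (S1 :&: S2); rewrite inE xS1 xS2 /=; lia.
(* No neighbourhood has two points any more. Hall's condition on singletons makes them nonempty, and
   on pairs it makes them distinct. *)
have N1 x : x \in D -> exists y, N x = [set y].
  move=> xD; apply/cards1P; rewrite eqn_leq; apply/andP; split.
    by have := small x; rewrite /= xD /=; lia.
  by have := hallN [set x]; rewrite sub1set big_set1 cards1; apply.
pose g x := odflt r0 [pick y in N x].
have Ng x : x \in D -> N x = [set g x].
  move=> /N1[y Nxy]; rewrite /g Nxy.
  by case: pickP => [z /set1P-> //|/(_ y)]; rewrite inE eqxx.
exists g => [x /Ng -> | x y xD yD gxy]; first exact: set11.
apply/eqP/negP=> /negP xy.
have := hallN [set x; y]; rewrite subUset !sub1set xD yD cards2 xy => /(_ isT).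
by rewrite bigcup_setU !big_set1 !Ng // gxy setUid cards1.
Qed.
End Hall.

(** * Degree sums in forests *)

Section Forest.
Variables (T : finType) (t : rel T).
Hypotheses (t_sym : symmetric t) (t_irr : irreflexive t).
Hypothesis t_acyclic : forall c : seq T, uniq c -> 3 <= size c -> ~~ cycle t c.

(** Otherwise a simple path could be prolonged forever at its head: the head has a neighbour in [A]
    other than the next vertex, and if that neighbour were on the path it would close a cycle of
    length at least 3. *)
Lemma acyclic_low_degree (A : {set T}) :
  A != set0 -> exists2 x, x \in A & #|[set y in A | t x y]| <= 1.
Proof.
case/set0Pn=> x0 x0A.
case: (pickP [pred x in A | #|[set y in A | t x y]| <= 1]) => [x /andP[]|big]; first by exists x.
have big2 x : x \in A -> 1 < #|[set y in A | t x y]|.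
  by move=> xA; have := big x; rewrite /= xA /=; lia.
have long m : exists x p, [/\ x \in A, path t x p, uniq (x :: p) & size p = m].
  elim: m => [|m [x [p [xA tp up sp]]]]; first by exists x0, [::].
  have [z zA [txz zhead]] : exists2 z, z \in A & t x z /\ z != head x p.
    have [y1 [y2 [+ + y12]]] := card_gt1P (big2 x xA).
    rewrite !inE => /andP[y1A ty1] /andP[y2A ty2].
    case: (eqVneq y1 (head x p)) => [y1h|]; last by exists y1.
    by exists y2 => //; split=> //; rewrite -y1h eq_sym.
  exists z, (x :: p); split=> //; last by rewrite /= sp.
    by rewrite /= t_sym txz.
  rewrite cons_uniq up andbT inE negb_or; apply/andP; split.
    by apply: contraTneq txz => ->; rewrite t_irr.
  apply/negP=> zp; case/splitPr: p / zp tp up zhead {sp} => p1 p2 tp up zhead.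
  have := @t_acyclic (x :: rcons p1 z).
  rewrite -cat_rcons -cat_cons cat_uniq in up; case/andP: up => -> _.
  move/(_ isT); rewrite /= size_rcons rcons_path last_rcons t_sym txz andbT.
  rewrite -cat_rcons cat_path in tp; case/andP: tp => -> _.
  by case: p1 zhead => [|? ?] /=; rewrite ?eqxx // => _ /(_ isT).
have [x [p [_ _ up sp]]] := long #|T|.
by have := max_card (mem (x :: p)); rewrite (card_uniqP up) /= sp ltnn.
Qed.

(** Delete a vertex of degree at most 1: the sum loses that degree twice, once at the vertex and
    once at its neighbour. *)
Lemma forest_degree_sum (A : {set T}) :
  A != set0 -> \sum_(x in A) #|[set y in A | t x y]| <= 2 * (#|A| - 1).
Proof.
have [m] := ubnP #|A|; elim: m A => // m IHm A ltm A0.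
have [x xA dx] := acyclic_low_degree A0.
have cA := cardsD1 x A; rewrite xA in cA.
have degD y : y \in A :\ x ->
    #|[set z in A | t y z]| = #|[set z in A :\ x | t y z]| + t x y.
  move=> _; rewrite (cardsD1 x) inE xA t_sym addnC /=; congr (#|pred_of_set _| + _).
  by apply/setP=> z; rewrite !inE andbA.
rewrite (big_setD1 x) //= (eq_bigr _ degD) big_split /=.
have -> : \sum_(y in A :\ x) t x y = #|[set y in A | t x y]|.
  rewrite -sum1dep_card big_mkcond [in RHS]big_mkcond; apply: eq_bigr => y _.
  rewrite !inE; case: eqP => [->|_] /=; first by rewrite t_irr andbF.
  by case: (y \in A); case: (t x y).
(* A single remaining vertex has no loop, hence degree 0; this is where the [- 1] comes from. *)
case: (eqVneq (A :\ x) set0) => [E|E].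
  rewrite E big_set0 in cA *; rewrite cards0 in cA.
  suff -> : [set y in A | t x y] = set0 by rewrite cards0; lia.
  apply/setP=> y; rewrite !inE; apply/negP=> /andP[yA txy].
  by have := in_set0 y; rewrite -E !inE yA andbT; case: eqP txy => // ->; rewrite t_irr.
have := IHm (A :\ x) _ E; have : 0 < #|A :\ x| by rewrite card_gt0.
move=> ? /(_ ltac:(lia)); lia.
Qed.
End Forest.

(** * Closed walks in multigraphs: Eulerian tours, detours and joins *)

Section Euler.
Variable T : finType.
Implicit Types (E R : seq {set T}) (x y z w : T).

(** A multigraph is a list of vertex sets: parallel edges are repeated entries, so the edges of a
    walk are compared with it by [perm_eq]. *)
Definition adj E : rel T := fun u w => [set u; w] \in E.

Fixpoint walk_edges x (p : seq T) : seq {set T} :=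
  if p is y :: p' then [set x; y] :: walk_edges y p' else [::].

Definition edge_deg E v := count (fun f : {set T} => v \in f) E.

(** Rules out loops, as [[set x; x]] is a singleton. *)
Definition pairs E := all (fun f : {set T} => #|f| == 2) E.

Lemma size_walk_edges x p : size (walk_edges x p) = size p.
Proof. by elim: p x => //= y p IHp x; rewrite IHp. Qed.

Lemma path_adj E x p : {subset walk_edges x p <= E} -> path (adj E) x p.
Proof.
elim: p x => //= y p IHp x sub; rewrite /adj sub ?mem_head //=.
by apply: IHp => f fE; apply: sub; rewrite inE fE orbT.
Qed.

Lemma walk_edges_cat x p q :
  walk_edges x (p ++ q) = walk_edges x p ++ walk_edges (last x p) q.
Proof. by elim: p x => //= y p IHp x; rewrite IHp. Qed.

Lemma mem_pair (f : {set T}) x : #|f| = 2 -> x \in f -> exists2 y, x != y & f = [set x; y].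
Proof.
move=> f2 xf; have := cardsD1 x f; rewrite xf f2 => -[] /esym/eqP/cards1P[y fy].
exists y; first by have := set11 y; rewrite -fy in_setD1 eq_sym => /andP[].
by rewrite -(setD1K xf) fy.
Qed.

Lemma in_pair_parity x y v : x != y -> (v \in [set x; y]) = (v == x) (+) (v == y).
Proof.
by move=> xy; rewrite !inE; case: (eqVneq v x) => //= ->; rewrite (negPf xy).
Qed.

Lemma perm_edge_deg E R : perm_eq E R -> edge_deg E =1 edge_deg R.
Proof. by move=> /permP ER v; apply: ER. Qed.

Lemma edge_deg_cat E R v : edge_deg (E ++ R) v = edge_deg E v + edge_deg R v.
Proof. exact: count_cat. Qed.

Lemma trail_exists R z w : pairs R ->
    (forall v, odd (edge_deg R v) = (v == z) (+) (v == w)) ->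
  exists q R', last z q = w /\ perm_eq R (walk_edges z q ++ R').
Proof.
have [m] := ubnP (size R); elim: m R z => // m IHm R z ltm pR oR.
case: (eqVneq z w) => [<-|zw]; first by exists [::], R.
have : has (fun f : {set T} => z \in f) R.
  by rewrite has_count; apply: odd_gt0; have := oR z; rewrite /edge_deg eqxx (negPf zw).
case/hasP=> f fR zf.
have [y zy fE] := mem_pair (eqP (allP pR f fR)) zf.
have pm := perm_to_rem fR.
have [||v|q [R' [lq pq]]] := IHm (rem f R) y.
- by have := perm_size pm; rewrite /=; lia.
- by apply/allP=> h /mem_rem; apply: (allP pR).
- have := oR v; rewrite (perm_edge_deg pm) /edge_deg /= oddD oddb fE in_pair_parity //.
  by rewrite -addbA => /addbI /= <-; rewrite addKb.
exists (y :: q), R'; split=> //=.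
by apply: perm_trans pm _; rewrite fE perm_cons -fE.
Qed.

(** The excursion [q] is inserted at a visit to [w]. Contents are given up to permutation: the
    vertices serve detours, the edges Eulerian tours. *)
Lemma closed_walk_splice x p w q :
    last x p = x -> w \in x :: p -> last w q = w ->
  exists p', [/\ last x p' = x, perm_eq p' (p ++ q),
    perm_eq (walk_edges x p') (walk_edges x p ++ walk_edges w q) &
    forall r : rel T, path r x p -> path r w q -> path r x p'].
Proof.
move=> lp wp lq; case/splitPl: wp lp => p1 p2 lw; rewrite last_cat lw => lp.
exists (p1 ++ q ++ p2); rewrite !last_cat lw lq lp; split=> //.
- by rewrite -catA perm_cat2l perm_catC.
- by rewrite !walk_edges_cat lw lq -catA perm_cat2l perm_catC.
- by move=> r; rewrite !cat_path lw lq => /andP[-> ->] ->.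
Qed.

Lemma walk_parity x p v : pairs (walk_edges x p) ->
  odd (edge_deg (walk_edges x p) v) = (v == x) (+) (v == last x p).
Proof.
elim: p x => [|y p IHp] x /=; first by rewrite addbb.
rewrite cards2; case: (eqVneq x y) => //= xy /IHp {}IHp.
by rewrite /edge_deg /= oddD IHp oddb in_pair_parity // addbA addbK.
Qed.

Lemma walk_edges_sub x p (f : {set T}) u : f \in walk_edges x p -> u \in f -> u \in x :: p.
Proof.
elim: p x => //= y p IHp x; rewrite inE => /orP[/eqP->|fp uf].
  by rewrite !inE => /orP[]/eqP->; rewrite eqxx ?orbT.
by rewrite inE (IHp y) ?orbT.
Qed.

Lemma euler_tour E x : pairs E -> (forall v, ~~ odd (edge_deg E v)) ->
    (forall u w, connect (adj E) u w) ->
  exists p, [/\ path (adj E) x p, last x p = x, forall v, v \in x :: p & size p = size E].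
Proof.
move=> pE evE cE.
suff grow m p R : size R < m -> last x p = x -> perm_eq E (walk_edges x p ++ R) ->
    exists p' R', [/\ last x p' = x, perm_eq E (walk_edges x p' ++ R') &
      forall (f : {set T}) u, f \in R' -> u \in f -> u \notin x :: p'].
  have [|p [R [lp pm noR]]] := @grow (size E).+1 [::] E (ltnSn _) erefl; first exact: perm_refl.
  have memE f : (f \in E) = (f \in walk_edges x p) || (f \in R).
    by rewrite (perm_mem pm) mem_cat.
  have all_p v : v \in x :: p.
    apply/negPn/negP=> vp; have vp' : v \notin [set u in x :: p] by rewrite inE.
    have xp : x \in [set u in x :: p] by rewrite inE mem_head.
    have [a [b []]] := connect_exit (cE x v) xp vp'.
    rewrite !in_set /adj memE => ap /negP bp /orP[/walk_edges_sub abp|/noR abp].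
      by apply: bp; rewrite abp // set22.
    by have := abp a; rewrite set21 ap => /(_ isT).
  exists p; split=> //; first by apply: path_adj => f fp; rewrite memE fp.
  case: R pm noR {memE} => [|f R] pm noR; first by rewrite (perm_size pm) cats0 size_walk_edges.
  have : #|f| == 2 by apply: (allP pE); rewrite (perm_mem pm) mem_cat mem_head orbT.
  case: (set_0Vmem f) => [->|[u uf]]; first by rewrite cards0.
  by have := noR f u (mem_head _ _) uf; rewrite all_p.
elim: m p R => // m IHm p R ltm lp pm.
case: (boolP (has (fun f : {set T} => [exists u in f, u \in x :: p]) R)); last first.
  move/hasPn=> noR; exists p, R; split=> // f u /noR + uf.
  by rewrite negb_exists => /forallP/(_ u); rewrite uf.
case/hasP=> f fR /existsP[w /andP[wf wp]].
have : pairs (walk_edges x p ++ R) by rewrite /pairs -(perm_all _ pm).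
rewrite /pairs all_cat => /andP[pW pR].
have [y wy fE] := mem_pair (eqP (allP pR f fR)) wf.
have pmR := perm_to_rem fR.
(* The walk is closed, so all degrees in [R] are even; without the edge [f] exactly [y] and [w]
   become odd, and a trail leads back from [y] to [w]. *)
have [||q [R' [lq pq]]] := @trail_exists (rem f R) y w.
- by apply/allP=> h /mem_rem; apply: (allP pR).
- move=> v; have := evE v; rewrite (perm_edge_deg pm) edge_deg_cat oddD walk_parity //.
  rewrite lp addbb /= (perm_edge_deg pmR) /edge_deg /= oddD oddb fE in_pair_parity //.
  by case: (odd _); case: (v == w); case: (v == y).
have [p' [lp' _ pme _]] := @closed_walk_splice x p w (y :: q) lp wp lq.
have pmq : perm_eq R (walk_edges w (y :: q) ++ R').
  by apply: perm_trans pmR _; rewrite fE /= perm_cons -fE.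
apply: (IHm p' R') => //.
  by have := perm_size pmq; rewrite size_cat /=; lia.
apply: perm_trans pm _; rewrite perm_sym; apply: perm_trans (perm_cat pme (perm_refl R')) _.
by rewrite -catA perm_cat2l perm_sym.
Qed.

(** An edge from a visited [a] to an unvisited [b] allows the excursion [a], [b], [a]: two steps for
    one new vertex. *)
Lemma detour_tour (e : rel T) x p : symmetric e -> (forall u w, connect e u w) ->
    path e x p -> last x p = x ->
  exists p', [/\ path e x p', last x p' = x, forall v, v \in x :: p' &
    size p' = size p + 2 * (#|T| - #|[set u in x :: p]|)].
Proof.
move=> e_sym e_conn.
have [m] := ubnP (#|T| - #|[set u in x :: p]|); elim: m p => // m IHm p ltm ep lp.
case: (pickP [pred v | v \notin x :: p]) => [v vp | all_p]; last first.
  exists p; split=> // [v|]; first by have := all_p v => /negbFE.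
  suff -> : [set u in x :: p] = setT by rewrite cardsT subnn addn0.
  by apply/setP=> u; rewrite !inE; have := all_p u => /negbFE; rewrite inE.
have [||a [b []]] := @connect_exit _ _ [set u in x :: p] _ _ (e_conn x v).
- by rewrite inE mem_head.
- by rewrite inE.
rewrite !in_set => ap bp eab.
have [p' [lp' pp' _ ep']] := @closed_walk_splice x p a [:: b; a] lp ap erefl.
have setp' : [set u in x :: p'] = b |: [set u in x :: p].
  apply/setP=> u; rewrite !inE (perm_mem pp') mem_cat !inE.
  case: (eqVneq u a) => [->|]; last by case: (u == x); case: (u \in p); case: (u == b).
  by move: ap; rewrite inE; case: (a == x); case: (a \in p); case: (a == b).
have cp' : #|[set u in x :: p']| = #|[set u in x :: p]|.+1.
  by rewrite setp' cardsU1 inE bp.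
have ltT : #|[set u in x :: p']| <= #|T| by apply: max_card.
have [|||p'' [ep'' lp'' cov sz]] := IHm p' => //.
- lia.
- by apply: ep' => //=; rewrite eab e_sym eab.
exists p''; split=> //.
rewrite sz (perm_size pp') size_cat cp'; move: ltT; rewrite cp' /=; lia.
Qed.

(* The colour [b] flips at every point of [O]; only the edges met while it is true are kept. *)
Fixpoint colour_edges (O : {set T}) (b : bool) x (s : seq T) : seq {set T} :=
  if s is y :: s' then
    (if b then [:: [set x; y]] else [::]) ++ colour_edges O (b (+) (y \in O)) y s'
  else [::].

Lemma colour_edges_sub O b x s : {subset colour_edges O b x s <= walk_edges x s}.
Proof.
elim: s b x => //= y s IHs b x f; rewrite mem_cat inE => /orP[|/IHs->]; last by rewrite orbT.
by case: b; rewrite // inE => ->.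
Qed.

Lemma size_colour_edges O b x s :
  size (colour_edges O b x s) + size (colour_edges O (~~ b) x s) = size s.
Proof.
elim: s b x => //= y s IHs b x; have := IHs (b (+) (y \in O)) y.
by rewrite !size_cat addNb; case: b => /=; lia.
Qed.

(** An inner visit has its incoming and outgoing edges of different colours exactly at points of
    [O], which gives the last term. The first two account for the start, with no incoming edge, and
    the end, with no outgoing one. *)
Lemma colour_edges_parity O b x s v : pairs (walk_edges x s) ->
  odd (edge_deg (colour_edges O b x s) v) =
  (b && (v == x)) (+) ((b (+) odd (count (mem O) s)) && (v == last x s))
   (+) (odd (count_mem v s) && (v \in O)).
Proof.
elim: s b x => [|y s IHs] b x /=; first by case: b; case: (v == x).
rewrite cards2; case: (eqVneq x y) => //= xy /IHs {}IHs.
rewrite edge_deg_cat oddD IHs !oddD !oddb addbA.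
have -> : odd (edge_deg (if b then [:: [set x; y]] else [::]) v)
   = b && ((v == x) (+) (v == y)).
  by case: b; rewrite //= /edge_deg /= addn0 oddb in_pair_parity.
rewrite [y == v]eq_sym; case: (eqVneq v y) => [->|_].
  by case: b; case: (y == x); case: (y \in O); case: (y == last y s);
     case: (odd (count (mem O) s)); case: (odd (count_mem y s)).
by case: b; case: (v == x); case: (v \in O); case: (y \in O); case: (v == last y s);
   case: (odd (count (mem O) s)); case: (odd (count_mem v s)).
Qed.
End Euler.

Lemma count_mem_sub (T : finType) (A : {set T}) (c : seq T) :
  uniq c -> {subset A <= c} -> count (mem A) c = #|A|.
Proof.
move=> uc Ac; rewrite -size_filter -(card_uniqP (filter_uniq _ uc)).
by apply: eq_card => x; rewrite mem_filter /= andb_idr //; apply: Ac.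
Qed.

(** * Fans and Dirac's theorem on cycles through prescribed vertices *)

Section Dirac.
Variables (T : finType) (e : rel T).
Hypotheses (e_sym : symmetric e) (e_irr : irreflexive e).

(* Match [m] copies of [v], and every [u] outside [C] other than [v], to distinct vertices
   in their (for [u]: closed) neighbourhoods. A violation of Hall's condition by [U]
   exhibits fewer than [m] vertices separating [v |: U] from [C]. *)
Lemma fan_matching (m : nat) (v : T) (C : {set T}) :
    vertex_connected e m -> m <= #|C| -> v \notin C ->
  exists (s : 'I_m -> T) (f : T -> T),
   [/\ forall i, e v (s i) /\ injective s,
       forall u, u \notin C -> u != v -> f u != v /\ (f u == u) || e u (f u),
       {in [pred u | (u \notin C) && (u != v)] &, injective f} &
       forall i u, u \notin C -> u != v -> f u != s i].
Proof.
move=> [_ e_conn] mC vC.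
pose D := [set l : 'I_m + T | if l is inr u then (u \notin C) && (u != v) else true].
pose N (l : 'I_m + T) :=
  if l is inr u then (u |: [set y | e u y]) :\ v else [set y | e v y].
have inlD i : inl i \in D by rewrite inE.
have inrD u : u \notin C -> u != v -> inr u \in D by rewrite inE => -> ->.
case: (@hall _ _ D v N) => [S SD | g gN gI].
  pose U := [set u | inr u \in S]; set W := \bigcup_(x in S) N x.
  have UD u : u \in U -> (u \notin C) && (u != v).
    by rewrite inE => /(subsetP SD); rewrite inE.
  have UW : U \subset W.
    apply/subsetP=> u uU; have /andP[_ uv] := UD u uU.
    by rewrite inE in uU; apply/bigcupP; exists (inr u); rewrite //= !inE uv eqxx.
  have inrI : injective (@inr 'I_m T) by move=> ? ? [].
  have inlI : injective (@inl 'I_m T) by move=> ? ? [].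
  (* If no copy of [v] is in [S], then [U] already supplies enough points, each [u] lying in its own
     closed neighbourhood. *)
  case: (pickP [pred i | inl i \in S]) => [i iS | noI]; last first.
    apply: leq_trans (subset_leq_card UW); rewrite -(card_imset _ inrI).
    apply/subset_leq_card/subsetP=> -[i|u] uS; first by have := noI i; rewrite /= uS.
    by apply: imset_f; rewrite inE.
  have leS : #|S| <= m + #|U|.
    have SU : S \subset (inl @: [set: 'I_m]) :|: (inr @: U).
      apply/subsetP=> -[j|u] uS; rewrite inE; apply/orP; [left | right];
      by apply: imset_f; rewrite inE.
    apply: leq_trans (subset_leq_card SU) _; rewrite cardsU !card_imset //.
    by rewrite cardsT card_ord leq_subr.
  apply: leq_trans leS _; rewrite -(cardsID U W) (setIidPr UW) addnC leq_add2l.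
  rewrite leqNgt; apply/negP=> X_lt.
  have vW : v \notin W.
    by apply/negP=> /bigcupP[[j|u] _] /=; rewrite !inE ?e_irr ?eqxx.
  have [b bC bX] : exists2 b, b \in C & b \notin W :\: U.
    apply/subsetPn; apply: contraTN X_lt => /subset_leq_card; lia.
  have conn : connect (del_vertices e (W :\: U)) v b.
    by apply: e_conn; rewrite // inE (negPf vW) andbF.
  have bA : b \notin v |: U.
    rewrite !inE negb_or; apply/andP; split; first by apply: contraNneq vC => <-.
    by apply: contraL bC => bS; have := UD b; rewrite inE bS => /(_ isT) /andP[].
  (* A path avoiding [W :\: U] cannot leave [v |: U], because all neighbours of that set outside it
     lie in [W]. *)
  have [a [a' [aA a'A]]] := connect_exit conn (setU11 v U) bA.
  move: a'A; rewrite in_setU1 negb_or => /andP[a'v a'U] /and3P[eaa' _].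
  rewrite inE a'U /= => /negP[]; apply/bigcupP.
  case/setU1P: aA => [av|aU].
    by exists (inl i); rewrite //= inE -av.
  by rewrite inE in aU; exists (inr a); rewrite //= !inE a'v eaa' orbT.
exists (g \o inl), (g \o inr); split.
- move=> i; split; first by have := gN _ (inlD i); rewrite inE.
  by move=> j k /= /gI gjk; have := gjk (inlD _) (inlD _) => -[].
- move=> u uC uv; have := gN _ (inrD u uC uv); rewrite !inE => /andP[-> ?].
  by split.
- move=> u w /andP[uC uv] /andP[wC wv] /= /gI guw.
  by have := guw (inrD _ uC uv) (inrD _ wC wv) => -[].
- move=> i u uC uv; apply/eqP=> /= /gI H.
  by have := H (inrD _ uC uv) (inlD i).
Qed.

(** The [i]-th path follows [f] from [s i] until it enters [C]. By injectivity orbits neither merge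
    nor repeat, so finiteness forces them into [C]. *)
Lemma fan (m : nat) (v : T) (C : {set T}) :
    vertex_connected e m -> m <= #|C| -> v \notin C ->
  exists (Q : 'I_m -> seq T) (y : 'I_m -> T),
   [/\ injective y, forall i, y i \in C,
       forall i, path e v (rcons (Q i) (y i)),
       forall i, uniq (Q i) /\ {in Q i, forall u, u \notin C /\ u != v} &
       forall i j, i != j -> ~~ has (mem (Q i)) (Q j)].
Proof.
move=> conn mC vC; have [s [f [sP fP fI fs]]] := fan_matching conn mC vC.
pose it i n := iter n f (s i).
pose free i n := forall a, a < n -> it i a \notin C.
have it_v i n : free i n -> it i n != v.
  elim: n => [|n IHn] fr; first by have [+ _] := sP i; apply: contraTneq => /= ->; rewrite e_irr.
  have fr' : free i n by move=> a an; apply: fr; lia.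
  by have [] := fP (it i n) (fr n (ltnSn n)) (IHn fr').
have freeW i n a : free i n -> a <= n -> free i a.
  by move=> fr an b ba; apply: fr; lia.
(* Equal iterates are pulled back through [f] until one is a starting point, a value that [f] does
   not take. *)
have it_inj i j a b : free i a -> free j b -> it i a = it j b -> a = b /\ i = j.
  elim: a b => [|a IHa] [|b] fa fb /=.
  - by have [_ sI] := sP i; move/sI.
  - move=> E; have := fs i (it j b) (fb b (ltnSn b)) (it_v _ _ (freeW _ _ _ fb (leqnSn b))).
    by rewrite -E eqxx.
  - move=> E; have := fs j (it i a) (fa a (ltnSn a)) (it_v _ _ (freeW _ _ _ fa (leqnSn a))).
    by rewrite E eqxx.
  have fa' := freeW _ _ _ fa (leqnSn a); have fb' := freeW _ _ _ fb (leqnSn b).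
  move=> E; have [] // := IHa b fa' fb' _; last by move=> -> ->.
  by apply: fI E; rewrite inE it_v // andbT ?fa ?fb.
have hit i : exists n, it i n \in C.
  case: (pickP [pred n : 'I_(#|T|.+1) | it i n \in C]) => [n|none]; first by exists n.
  have inj : injective (fun n : 'I_(#|T|.+1) => it i n).
    move=> a b E; apply: val_inj => /=.
    have fr (n : 'I_(#|T|.+1)) : free i n.
      move=> c cn; have ltc : c < #|T|.+1 by apply: ltn_trans cn (ltn_ord n).
      by have := none (Ordinal ltc) => /= ->.
    by have [] := it_inj i i a b (fr a) (fr b) E.
  by have := leq_card _ inj; rewrite card_ord ltnn.
pose n i := ex_minn (hit i).
have nC i : it i (n i) \in C by rewrite /n; case: ex_minnP.
have nfree i : free i (n i).
  by rewrite /n; case: ex_minnP => k _ mink a; rewrite ltnNge; apply: contra => /mink.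
pose Q i := traject f (s i) (n i).
have QP i u : u \in Q i -> exists2 a, a < n i & u = it i a.
  by case/trajectP=> a; exists a.
exists Q, (fun i => it i (n i)); split=> //.
- by move=> i j E; have [] := it_inj i j _ _ (@nfree i) (@nfree j) E.
- move=> i; rewrite -trajectSr /= (proj1 (sP i)) /=.
  have : free i (n i) by apply: nfree.
  elim: (n i) => // k IHk fr; rewrite trajectSr rcons_path IHk; last exact: freeW fr _.
  rewrite last_traject /= -/(it i k).
  have itv := it_v _ _ (freeW _ _ _ fr (leqnSn k)).
  (* The matching allows [f u = u], but on an orbit this would be a repetition. *)
  have [_ /orP[/eqP E|]] := fP (it i k) (fr k (ltnSn k)) itv.
  by have [] := it_inj i i k.+1 k fr (freeW _ _ _ fr (leqnSn k)) E; lia.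
  by rewrite -iterSr.
- move=> i; split.
    rewrite /Q; apply/(uniqP (s i)) => a b; rewrite !inE size_traject => an bn.
    rewrite !nth_traject // => E.
    by have [] := it_inj i i a b (freeW _ _ _ (@nfree i) (ltnW an)) (freeW _ _ _ (@nfree i) (ltnW bn)) E.
  move=> u /QP[a an ->]; split; first exact: nfree an.
  exact/it_v/freeW/ltnW/an/nfree.
- move=> i j ij; apply/hasPn=> u /QP[b bn ->]; apply/negP=> /QP[a an E].
  have [_ ji] := it_inj j i b a (freeW _ _ _ (@nfree j) (ltnW bn)) (freeW _ _ _ (@nfree i) (ltnW an)) E.
  by rewrite ji eqxx in ij.
Qed.

(* In the first clause, [y :: a] is the stretch already read since the last point of [Y]. *)
Lemma linear_gap (O Y : {set T}) (s : seq T) :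
  (forall y a, y \in Y -> ~~ has (mem O) a -> ~~ has (mem Y) a ->
     count (mem O) s < count (mem Y) s ->
     exists l y1 a1 y2 r, [/\ y :: a ++ s = l ++ y1 :: a1 ++ y2 :: r,
       y1 \in Y, y2 \in Y, ~~ has (mem O) a1 & ~~ has (mem Y) a1]) /\
  (count (mem O) s + 1 < count (mem Y) s ->
     exists l y1 a1 y2 r, [/\ s = l ++ y1 :: a1 ++ y2 :: r,
       y1 \in Y, y2 \in Y, ~~ has (mem O) a1 & ~~ has (mem Y) a1]).
Proof.
elim: s => [|z s [IHA IHB]]; first by split=> //= [y a _ _ _|]; rewrite ltn0.
have extend p : (exists l y1 a1 y2 r, [/\ s = l ++ y1 :: a1 ++ y2 :: r,
       y1 \in Y, y2 \in Y, ~~ has (mem O) a1 & ~~ has (mem Y) a1]) ->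
    exists l y1 a1 y2 r, [/\ p ++ s = l ++ y1 :: a1 ++ y2 :: r,
       y1 \in Y, y2 \in Y, ~~ has (mem O) a1 & ~~ has (mem Y) a1].
  case=> l [y1 [a1 [y2 [r [-> *]]]]].
  by exists (p ++ l), y1, a1, y2, r; rewrite catA.
split=> [y a yY aO aY /=|/=].
  case: (boolP (z \in Y)) => zY; first by move=> _; exists [::], y, a, z, s.
  case: (boolP (z \in O)) => zO /= lt.
    (* The point [z] of [O] spoils the current stretch, but no longer counting it pays for the slack
       1 of the second clause. *)
    by rewrite -cat_cons -cat_rcons; apply: extend; apply: IHB; lia.
  by rewrite -cat_rcons; apply: IHA => //; rewrite has_rcons /= ?(negPf zO) ?(negPf zY).
case: (boolP (z \in Y)) => zY lt.
  by have := @IHA z [::] zY isT isT; apply; lia.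
by apply: (extend [:: z]); apply: IHB; lia.
Qed.

(** Pigeonhole: [Y] cuts the cycle into [#|Y|] arcs, more than there are points of [O] on it. *)
Lemma cycle_gap (O Y : {set T}) (c : seq T) : uniq c -> {subset Y <= c} ->
    1 < #|Y| -> #|[set x in c | x \in O]| < #|Y| ->
  exists y1 a y2 r, [/\ perm_eq (y1 :: a ++ y2 :: r) c,
    cycle e (y1 :: a ++ y2 :: r) = cycle e c, y1 \in Y, y2 \in Y & ~~ has (mem O) a].
Proof.
move=> uc Yc Y2 ltO.
have count_set (A : {set T}) : count (mem A) c = #|[set x in c | x \in A]|.
  rewrite -size_filter -(card_uniqP (filter_uniq _ uc)).
  by apply: eq_card => x; rewrite !inE mem_filter andbC.
have countY := count_mem_sub uc Yc.
have /set0Pn[y0 y0Y] : Y != set0 by rewrite -card_gt0; lia.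
have [i s rc] := rot_to (Yc _ y0Y).
have perm_c : perm_eq (rcons s y0) c by rewrite perm_rcons -rc perm_rot.
(* The cycle is read from [y0] back to [y0], so that the arc closing at [y0] is seen as well. *)
have [/(_ y0 [::] y0Y isT isT) gap _] := linear_gap O Y (rcons s y0).
rewrite !(permP perm_c) countY count_set in gap.
have {gap} [l [y1 [a [y2 [r [E y1Y y2Y aO aY]]]]]] := gap ltO.
have rot_c j c' : rot j (y0 :: s) = c' -> perm_eq c' c /\ cycle e c' = cycle e c.
  by move=> <-; rewrite -rc !rot_cycle !perm_rot.
(* Either the gap ends at the repeated [y0], or that last entry is a duplicate to be dropped. A gap
   spanning the whole cycle would leave [y0] as the only point of [Y]. *)
case/lastP: r E => [|r z]; rewrite -?cats1 -[y0 :: s ++ _]cat_cons.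
  case: l => [|z l].
    rewrite !cats1 => -[_] /rcons_inj [sa _].
    move: aY; rewrite has_count -eqn0Ngt => /eqP aY.
    by have := countY; rewrite -(permP perm_c) sa -cats1 count_cat aY /= y0Y; lia.
  rewrite !cats1 => -[_]; rewrite -rcons_cons -rcons_cat => /rcons_inj [sE _].
  exists y1, a, y0, l; have [] // := rot_c (size (y0 :: l)) (y1 :: a ++ y0 :: l).
  by rewrite sE -cat_cons rot_size_cat.
rewrite -[y2 :: _]cat_cons catA -cat_cons catA !cats1 => /rcons_inj[sE _].
exists y1, a, y2, (r ++ l); have [] // := rot_c (size l) (y1 :: a ++ y2 :: r ++ l).
by rewrite sE rot_size_cat /= -catA.
Qed.

(** Two paths of a fan from [v] end at [y1] and [y2] with no point of [O] strictly between them on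
    the cycle; these paths replace that arc. *)
Lemma dirac_step (m : nat) (O : {set T}) (c : seq T) (v : T) :
    vertex_connected e m -> 2 <= m -> #|O| <= m -> 1 < size c -> uniq c -> cycle e c ->
    v \in O -> v \notin c ->
  exists c', [/\ 1 < size c', uniq c', cycle e c', v \in c' & {in O, {subset c <= c'}}].
Proof.
move=> conn m2 Om c2 uc cyc vO vc.
pose C := [set x in c].
have cC : #|C| = size c by rewrite cardsE; apply/card_uniqP.
pose k := minn m #|C|.
have kconn : vertex_connected e k.
  case: conn => lt conn; split; first exact: leq_ltn_trans (geq_minl _ _) lt.
  by move=> X Xk; apply: conn; apply: leq_trans Xk (geq_minl _ _).
have vC : v \notin C by rewrite inE.
have [Q [y [yI yC pQ uQ dQ]]] := fan kconn (geq_minr _ _) vC.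
pose Y := [set y i | i : 'I_k].
have cY : #|Y| = k by rewrite card_imset // card_ord.
have Yc : {subset Y <= c} by move=> _ /imsetP[i _ ->]; have := yC i; rewrite inE.
have gap : exists y1 a y2 r, [/\ perm_eq (y1 :: a ++ y2 :: r) c,
    cycle e (y1 :: a ++ y2 :: r) = cycle e c, y1 \in Y, y2 \in Y & ~~ has (mem O) a].
  (* On a long cycle there are [m] feet but at most [m - 1] points of [O], as [v] is off it. On a
     short one every vertex is a foot, and any edge is a gap. *)
  case: (leqP m #|C|) => mC.
    apply: cycle_gap => //; first by rewrite cY /k; lia.
    rewrite cY /k (minn_idPl mC); apply: leq_trans Om; apply: proper_card.
    apply/properP; split; first by apply/subsetP=> x; rewrite inE => /andP[].
    by exists v; rewrite // inE (negPf vc).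
  have YC : Y = C.
    apply/eqP; rewrite eqEcard cY /k (minn_idPr (ltnW mC)) leqnn andbT.
    by apply/subsetP=> x /Yc; rewrite inE.
  have [y1 [y2 [r cE]]] : exists y1 y2 r, c = y1 :: y2 :: r.
    by case: (c) c2 => [|y1 [|y2 r]] // _; exists y1, y2, r.
  by exists y1, [::], y2, r; rewrite YC !inE /= -cE cE !inE !eqxx orbT.
case: gap => y1 [a [y2 [r [pm <- /imsetP[i _ y1E] /imsetP[j _ y2E] aO]]]] in cyc *.
have := uc; rewrite -(perm_uniq pm) => uc'.
have memc x : (x \in c) = (x \in y1 :: a ++ y2 :: r) by rewrite (perm_mem pm).
have ij : i != j.
  apply: contraTneq uc' => ij; rewrite y1E y2E ij /= mem_cat mem_head orbT //.
have cQ l x : x \in Q l -> x \notin c.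
  by have [_ QC] := uQ l; move=> /QC[]; rewrite inE.
have vQ l : v \notin Q l.
  by apply/negP=> vQ; have [_ QC] := uQ l; have [_ /eqP] := QC v vQ.
exists (y1 :: rev (Q i) ++ v :: Q j ++ y2 :: r); split.
- by rewrite /= !size_cat /= addnS.
- have ur : uniq (y1 :: y2 :: r).
    apply: subseq_uniq uc'; rewrite /= eqxx; exact: suffix_subseq.
  have pm' : perm_eq (y1 :: rev (Q i) ++ v :: Q j ++ y2 :: r)
                     ((v :: Q i ++ Q j) ++ y1 :: y2 :: r).
    by apply/permP=> p; rewrite /= !count_cat /= count_rev !count_cat /=; lia.
  rewrite (perm_uniq pm') cat_uniq ur andbT; apply/andP; split.
    rewrite /= mem_cat !(negPf (vQ _)) cat_uniq.
    by rewrite (proj1 (uQ i)) (proj1 (uQ j)) dQ.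
  apply/hasPn=> x xr; have xc : x \in c.
    by rewrite memc; move: xr; rewrite !(inE, mem_cat) => /or3P[->|->|->]; rewrite ?orbT.
  rewrite inE mem_cat !negb_or; apply/and3P; split.
  + by apply: contraNneq vc => <-.
  + exact: contraL (@cQ i x) xc.
  + exact: contraL (@cQ j x) xc.
- have back : path e y1 (rcons (rev (Q i)) v).
    have := pQ i; rewrite -y1E (eq_path (e' := fun z => e^~ z)) => [|? ? /=]; last exact: e_sym.
    by rewrite -rev_path last_rcons belast_rcons rev_cons.
  have forth := pQ j; rewrite -y2E in forth.
  move: cyc; rewrite /= rcons_cat /= cat_path /= => /and3P[_ _ pr].
  rewrite -cat_rcons rcons_cat cat_path back last_rcons /=.
  by rewrite -cat_rcons rcons_cat cat_path forth last_rcons.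
- by rewrite inE mem_cat mem_head !orbT.
- move=> x xO; rewrite memc !(inE, mem_cat) => /or3P[->|xa|/orP[->|->]]; rewrite ?orbT //.
  by case/hasP: aO; exists x.
Qed.

(** Start from an edge at a point of [O], counted as a cycle of length 2, and absorb the missing
    points one by one. *)
Theorem dirac (m : nat) (O : {set T}) :
    vertex_connected e m -> 2 <= m -> O != set0 -> #|O| <= m ->
  exists c, [/\ 1 < size c, uniq c, cycle e c & {subset O <= c}].
Proof.
move=> conn m2 /set0Pn[o oO] Om.
have [b ob] : exists b, e o b.
  have [b] : exists b, b \in [set~ o].
    by apply/set0Pn; rewrite -card_gt0 cardsC1; case: conn; lia.
  rewrite in_setC1 => bo; have [_ /(_ set0)] := conn; rewrite cards0 => /(_ ltac:(lia) o b).
  rewrite !inE => /(_ isT isT) /connect_exit - /(_ [set o] (set11 o)).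
  by rewrite in_set1 => /(_ bo)[x [z [/set1P-> _ /and3P[oz _ _]]]]; exists z.
suff grow d c : #|O :\: [set x in c]| < d -> 1 < size c -> uniq c -> cycle e c ->
    exists c, [/\ 1 < size c, uniq c, cycle e c & {subset O <= c}].
  apply: (@grow _ [:: o; b]) => //=; last by rewrite ob e_sym ob.
  by rewrite inE andbT; apply: contraTneq ob => <-; rewrite e_irr.
elim: d c => // d IHd c ltd c2 uc cyc.
case: (boolP (O \subset [set x in c])) => [/subsetP sub | /subsetPn[v vO]].
  by exists c; split=> // x /sub; rewrite inE.
rewrite inE => vc; have [c' [c'2 uc' cyc' vc' sub]] := dirac_step conn m2 Om c2 uc cyc vO vc.
apply: (IHd c') => //; rewrite -ltnS; apply: leq_trans ltd; apply: proper_card.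
apply/properP; split; last by exists v; rewrite !inE ?vc' ?vc ?vO.
by apply/subsetP=> x; rewrite !inE => /andP[xc' xO]; rewrite xO andbT; apply: contra (sub x xO) xc'.
Qed.
End Dirac.

(** * Parity, edge lists and the handshake identity *)

Lemma card_odd_support (T : finType) (F : T -> nat) :
  odd (\sum_v F v) = odd #|[set v | odd (F v)]|.
Proof.
have -> : \sum_v F v = #|[set v | odd (F v)]| + (\sum_v (F v)./2).*2.
  rewrite -sum1dep_card [X in _ = X + _]big_mkcond -mul2n big_distrr -big_split; apply: eq_bigr => v _ /=.
  by rewrite -{1}[F v]odd_double_half mul2n; case: (odd _).
by rewrite oddD odd_double addbF.
Qed.

Section EdgeList.
Variables (T : finType) (r : rel T).
Hypotheses (r_sym : symmetric r) (r_irr : irreflexive r).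

(** Enumerating a set of unordered pairs lists each edge once, although [r] relates its ends in both
    orders. *)
Definition edge_list : seq {set T} :=
  enum [set [set u.1; u.2] | u in [pred u : T * T | r u.1 u.2]].

Lemma mem_edge_list u w : ([set u; w] \in edge_list) = r u w.
Proof.
rewrite mem_enum; apply/imsetP/idP => [[[x y] /= rxy E] | ruw]; last by exists (u, w).
have uw : u != w.
  have := congr1 (fun f : {set T} => #|f|) E; rewrite !cards2.
  by case: (eqVneq x y) rxy => [->|_ _]; [rewrite inE /= r_irr | case: eqP].
have := set21 u w; have := set22 u w; rewrite E => /set2P[]wE /set2P[]uE;
  by rewrite ?uE ?wE ?eqxx // in uw *; rewrite r_sym.
Qed.

Lemma pairs_edge_list : pairs edge_list.
Proof.
apply/allP=> f; rewrite mem_enum => /imsetP[[x y] /= rxy ->].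
by rewrite cards2; case: (eqVneq x y) rxy => // ->; rewrite inE /= r_irr.
Qed.

Lemma edge_deg_edge_list v : edge_deg edge_list v = deg r v.
Proof.
have uE : uniq edge_list by apply: enum_uniq.
rewrite /edge_deg -size_filter -(card_uniqP (filter_uniq _ uE)).
have vI : {in [set y | r v y] &, injective (fun y => [set v; y])}.
  move=> y z; rewrite !inE => vy vz /setP E.
  have := E y; rewrite !inE eqxx orbT => /esym/orP[/eqP yv|/eqP//].
  by rewrite yv r_irr in vy.
rewrite /deg -(card_in_imset vI); apply: eq_card => f; rewrite mem_filter.
apply/andP/imsetP=> [[vf fE] | [y + ->]]; last by rewrite inE set21 mem_edge_list.
have [y _ fy] := mem_pair (eqP (allP pairs_edge_list f fE)) vf.
by exists y => //; rewrite inE -mem_edge_list -fy.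
Qed.

Lemma walk_edges_edge_list x p :
  path r x p -> {subset walk_edges x p <= edge_list}.
Proof.
elim: p x => //= y p IHp x /andP[rxy rp] f; rewrite inE => /orP[/eqP->|]; last exact: IHp.
by rewrite mem_edge_list.
Qed.
End EdgeList.

Lemma handshake (T : finType) (E : seq {set T}) :
  pairs E -> \sum_v edge_deg E v = 2 * size E.
Proof.
elim: E => [|f E IHE] /=; first by rewrite big1.
case/andP=> /eqP f2 /IHE {}IHE.
rewrite big_split /= -[X in _ + X]/(\sum_v edge_deg E v) IHE.
suff -> : \sum_v (v \in f : nat) = 2 by rewrite mulnS.
by rewrite -f2 -sum1_card [RHS]big_mkcond; apply: eq_bigr => v _; case: (v \in f).
Qed.

(** * The three tours and their average *)

Theorem theorem3 (k : nat) (T : finType) (e : rel T) :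
  2 <= k ->
  simple_graph e ->
  vertex_connected e (2 * (k - 1)) ->
  vertex_connected e 2 ->
  (exists t : rel T, spanning_tree e t /\ #|leaves t| = k) ->
  exists (x : T) (p : seq T), tsp_tour e x p /\ 3 * size p <= 4 * #|T|.
Proof.
move=> k2 [e_sym e_irr] conn _ [t [[t_sym [te [t_conn t_acyc]]] tk]].
have t_irr : irreflexive t by move=> x; apply/negP=> /te; rewrite e_irr.
have n_gt : 2 * (k - 1) < #|T| by case: conn.
set TE := edge_list t; have pTE : pairs TE := pairs_edge_list t_irr.
have degTE v : edge_deg TE v = deg t v by apply: edge_deg_edge_list.
have sumTE : \sum_v deg t v = 2 * size TE.
  by rewrite -handshake //; apply: eq_bigr => v _; rewrite degTE.
have sizeTE : size TE <= #|T| - 1.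
  have T0 : [set: T] != set0 by rewrite -card_gt0 cardsT; lia.
  have := forest_degree_sum t_sym t_irr t_acyc T0.
  suff -> : \sum_(x in [set: T]) #|[set y in [set: T] | t x y]| = \sum_v deg t v.
    by rewrite sumTE cardsT; lia.
  by apply: eq_big => [x|x _]; rewrite ?inE //; apply: eq_card => y; rewrite !inE.
have deg_gt0 v : 0 < deg t v.
  have [b] : exists b, b \in [set~ v].
    by apply/set0Pn; rewrite -card_gt0 cardsC1; lia.
  rewrite in_setC1 => bv.
  have bv' : b \notin [set v] by rewrite in_set1.
  have [x [z [/set1P-> _ tvz]]] := connect_exit (t_conn v b) (set11 v) bv'.
  by apply/card_gt0P; exists z; rewrite inE.
pose O := [set v | odd (deg t v)].
have O_even : ~~ odd #|O| by rewrite -card_odd_support sumTE oddM.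
have O_card : #|O| <= 2 * (k - 1).
  (* The pointwise bound is tight for degrees 1, 2 and 3; summed up it reads
     [2n + #|O| <= 2(n - 1) + 2k]. *)
  have : \sum_(v : T) (2 + (v \in O)) <= \sum_v (deg t v + 2 * (v \in leaves t)).
    apply: leq_sum => v _; rewrite !inE; have := deg_gt0 v.
    by case: (deg t v) => [|[|[|d]]] //= _; case: (odd _); lia.
  have cardE (A : {set T}) : \sum_v (v \in A : nat) = #|A|.
    by rewrite -sum1_card [RHS]big_mkcond; apply: eq_bigr => v _; case: (v \in A).
  have -> : \sum_v (2 + (v \in O)) = 2 * #|T| + #|O|.
    by rewrite big_split /= cardE sum_nat_const mulnC.
  have -> : \sum_v (deg t v + 2 * (v \in leaves t)) = 2 * size TE + 2 * k.
    by rewrite big_split /= sumTE -[X in _ + X]big_distrr /= cardE tk.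
  lia.
have O0 : O != set0.
  have : leaves t != set0 by rewrite -card_gt0 tk; lia.
  by case/set0Pn=> v; rewrite inE => /eqP dv; apply/set0Pn; exists v; rewrite inE dv.
have [c [c2 uc cyc Oc]] := dirac e_sym e_irr conn ltac:(lia) O0 O_card.
case: c c2 uc cyc Oc => // x s _ uc cyc Oc.
pose p := rcons s x; have p_last : last x p = x by rewrite last_rcons.
have e_p : path e x p := cyc.
have perm_p : perm_eq p (x :: s) by rewrite perm_rcons.
have pWp : pairs (walk_edges x p).
  apply/allP=> f /(walk_edges_edge_list e_sym e_irr e_p).
  exact: (allP (pairs_edge_list e_irr)).
(* As [#|O|] is even, the colour on returning to [x] is the initial one and the two end terms
   cancel: both colour classes are [O]-joins. *)
have oddJ b v : odd (edge_deg (colour_edges O b x p) v) = (v \in O).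
  rewrite colour_edges_parity // p_last !(permP perm_p) count_mem_sub //.
  rewrite (negPf O_even) addbF addbb /= -[_ + _]/(count_mem v (x :: s)).
  by rewrite count_uniq_mem // oddb andb_idl //; apply: Oc.
have tour b : exists q, tsp_tour e x q /\ size q = size TE + size (colour_edges O b x p).
  pose E := TE ++ colour_edges O b x p.
  have Ee : {subset E <= edge_list e}.
    move=> f; rewrite mem_cat => /orP[|/colour_edges_sub]; last exact: walk_edges_edge_list.
    rewrite !mem_enum => /imsetP[u tu ->]; apply: imset_f; exact: te.
  have [| |u w|q [Eq lq cov sq]] := @euler_tour T E x.
  - by apply/allP=> f /Ee; apply: (allP (pairs_edge_list e_irr)).
  - by move=> v; rewrite edge_deg_cat oddD degTE oddJ inE addbb.
  - apply: connect_sub (t_conn u w) => a a' ta; apply: connect1.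
    by rewrite /adj mem_cat mem_edge_list // ta.
  exists q; rewrite sq size_cat; split=> //; split=> //.
  by apply: sub_path Eq => a a' /Ee; rewrite mem_edge_list.
have [q0 [tour0 s0]] := tour false; have [q1 [tour1 s1]] := tour true.
have e_conn u w : connect e u w.
  by apply: connect_sub (t_conn u w) => a b /te; apply: connect1.
have [q2 [e2 l2 cov2 s2]] := detour_tour e_sym e_conn e_p p_last.
have tour2 : tsp_tour e x q2 by [].
have c_p : #|[set u in x :: p]| = size p.
  rewrite (perm_size perm_p) -(card_uniqP uc); apply: eq_card => u.
  by rewrite inE in_cons (perm_mem perm_p) !inE orbA orbb.
have := size_colour_edges O true x p.
have p_le : size p <= #|T| by rewrite -c_p max_card.
rewrite c_p in s2 => /= sJ.
(* If both Eulerian tours are too long, then [3|c| > 2n], so the third tour, of length [2n - |c|],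
   is short enough. *)
case: (leqP (3 * size q0) (4 * #|T|)) => h0; first by exists x, q0.
case: (leqP (3 * size q1) (4 * #|T|)) => h1; first by exists x, q1.
exists x, q2; split=> //; rewrite s2; move: p_le h0 h1; rewrite s0 s1 -sJ; move: (#|T|) (size _) (size _) (size TE) sizeTE => n a b m; lia.
Qed.
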